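(* Let $\mathbb F$ be a field of characteristic $0$, $\mathcal A=M_m(\mathbb F)$, let $S\in\mathcal A\langle\!\langle\underline x\rangle\!\rangle$ and let $\mathcal H_S$ be its Hankel module. Then $\mathcal H_S$ is finitely generated as a left $\mathcal A$-module if and only if $S$ is recognizable. If this is the case, then the minimal cardinality of a generating set of $\mathcal H_S$ equals the dimension of a minimal representation of $S$.
   Context: $\underline x=\{x_1,\dots,x_g\}$ is a finite alphabet and $\langle\underline x\rangle$ is the free monoid of words in these freely noncommuting letters, with empty word $1$ and length $|w|$. $\mathcal A\langle\underline x\rangle=\mathcal A*_{\mathbb F}\mathbb F\langle\underline x\rangle$ (free product of unital $\mathbb F$-algebras) and $\mathcal A\langle\!\langle\underline x\rangle\!\rangle$ is its $(\underline x)$-adic completion. For $w=w_1\cdots w_\ell$, $\mathcal A^w$ is the $\mathbb F$-span of all $a_0w_1a_1\cdots w_\ell a_\ell$, $a_i\in\mathcal A$. Every series is uniquely $S=\sum_w[S,w]$ with $[S,w]\in\mathcal A^w$. A (linear) representation of dimension $n$ of $S$ is $(\mathbf c,A,\mathbf b)$ with $\mathbf c\in\mathcal A^{1\times n}$, $\mathbf b\in\mathcal A^{n\times1}$, $A^x\in(\mathcal A^x)^{n\times n}$ ($x\in\underline x$) and $[S,w]=\mathbf cA^w\mathbf b$ for all words $w$, where $A^w=A^{w_1}\cdots A^{w_{|w|}}$. The zero series (only) has a representation of dimension $0$. $S$ is recognizable if it has a representation; a representation is minimal if its dimension is minimal among all representations of $S$. For a letter $x$ put $L_xS=\sum_{w}[S,xw]$.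 A left $\mathcal A$-submodule $\mathcal M\subseteq\mathcal A\langle\!\langle\underline x\rangle\!\rangle$ is stable if $L_xT\in\mathcal A^x\mathcal M$ (finite sums of products of elements of $\mathcal A^x$ and $\mathcal M$) for every $x\in\underline x$ and $T\in\mathcal M$. For every $S$ there exists a smallest stable left $\mathcal A$-submodule of $\mathcal A\langle\!\langle\underline x\rangle\!\rangle$ containing $S$; it is called the Hankel module of $S$ and denoted $\mathcal H_S$. Explicitly, it is generated as a left $\mathcal A$-module by all series obtained from $S$ by applying finitely many (possibly zero) operators $L_{x,e_{ij}}$, $x\in\underline x$, $1\le i,j\le m$, where $e_{ij}$ are the standard matrix units and $L_{x,a}S$ is obtained from $L_xS$ by replacing the first letter ($x$) in every term with $a\in\mathcal A$. *)

(* Defs.v *)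
From HB Require Import structures.
From mathcomp Require Import all_boot all_algebra finmap.
From mathcomp Require Import boolp classical_sets.

Set Implicit Arguments.
Unset Strict Implicit.
Unset Printing Implicit Defensive.

Import GRing.Theory.
Local Open Scope ring_scope.

(* Write A = 'M[F]_m and e_p for the matrix unit at p = (i, j).  The pair
     (p0, [:: (x1, p1); ...; (xl, pl)])
   stands for the monomial e_p0 x1 e_p1 ... xl e_pl of the free product A<X> of
   A with the free algebra on X.  As A^w, for a word w of length l, is the
   tensor power of A with l + 1 factors, the monomials of word w form an
   F-basis of it: see [monomialE] and [component_Hom] below. *)
Definition munit (m : nat) : finType := ('I_m * 'I_m)%type.
Definition mono (m : nat) (X : finType) : Type :=
  (munit m * seq (X * munit m))%type.
Definition mword (m : nat) (X : finType) (u : mono m X) : seq X := unzip1 u.2.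

(* A<<X>>, the product of all the A^w: a series is an arbitrary family of
   coefficients, because a word supports finitely many monomials. *)
Record gseries (F : fieldType) (m : nat) (X : finType) :=
  GSeries { coef : mono m X -> F }.
Arguments GSeries {F m X}.

Section Ring.
Variables (F : fieldType) (m : nat) (X : finType).
Local Notation E := (munit m).
Local Notation mono := (mono m X).
Local Notation gseries := (gseries F m X).
Implicit Types (S T U : gseries) (u : mono) (p q : E) (s : seq (X * E)).

Lemma gseriesP S T : (forall p s, coef S (p, s) = coef T (p, s)) -> S = T.
Proof.
case: S T => [a] [b] /= ab; congr GSeries; apply: funext => -[p s]; exact: ab.
Qed.

HB.instance Definition _ := gen_eqMixin gseries.
HB.instance Definition _ := gen_choiceMixin gseries.

Definition sadd S T := GSeries (fun u => coef S u + coef T u).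
Definition sopp S := GSeries (fun u => - coef S u).
Definition szero : gseries := GSeries (fun=> 0).

Fact saddA : associative sadd.
Proof. by move=> S T U; apply: gseriesP => p s /=; rewrite addrA. Qed.
Fact saddC : commutative sadd.
Proof. by move=> S T; apply: gseriesP => p s /=; rewrite addrC. Qed.
Fact sadd0 : left_id szero sadd.
Proof. by move=> S; apply: gseriesP => p s /=; rewrite add0r. Qed.
Fact saddN : left_inverse szero sopp sadd.
Proof. by move=> S; apply: gseriesP => p s /=; rewrite addNr. Qed.

HB.instance Definition _ :=
  GRing.isZmodule.Build gseries saddA saddC sadd0 saddN.

Definition sscale (k : F) S := GSeries (fun u => k * coef S u).
Fact sscaleA (a b : F) S : sscale a (sscale b S) = sscale (a * b) S.
Proof. by apply: gseriesP => p s /=; rewrite mulrA. Qed.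
Fact sscale1 : left_id 1 sscale.
Proof. by move=> S; apply: gseriesP => p s /=; rewrite mul1r. Qed.
Fact sscaleDr : right_distributive sscale +%R.
Proof. by move=> a S T; apply: gseriesP => p s /=; rewrite mulrDr. Qed.
Fact sscaleDl S : {morph sscale^~ S : a b / a + b}.
Proof. by move=> a b; apply: gseriesP => p s /=; rewrite mulrDl. Qed.

HB.instance Definition _ := GRing.Zmodule_isLmodule.Build F gseries
  sscaleA sscale1 sscaleDr sscaleDl.

(* The product of monomials is induced by e_(i, r) * e_(r, j) = e_(i, j), so the
   coefficient of S * T at e_p0 x1 e_p1 ... xl e_pl is the sum over k <= l and r
   of the coefficient of S at e_p0 x1 ... xk e_(pk.1, r) times that of T at
   e_(r, pk.2) x(k+1) ... xl e_pl.  In the recursion the sum over r is the term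
   k = 0. *)
Definition shift p x S := GSeries (fun u => coef S (p, (x, u.1) :: u.2)).

Fixpoint smul_coef S T p s : F :=
  \sum_r coef S ((p.1, r), [::]) * coef T ((r, p.2), s) +
  (if s is (x, q) :: s' then smul_coef (shift p x S) T q s' else 0).
Definition smul S T := GSeries (fun u => smul_coef S T u.1 u.2).

(* The embedding of A, and the letters x = 1 x 1. *)
Definition iota (a : 'M[F]_m) : gseries :=
  GSeries (fun u => if u.2 is [::] then a u.1.1 u.1.2 else 0).
Definition letter (x : X) : gseries :=
  GSeries (fun u => if u is (p, [:: (y, q)])
                    then ((x == y) && (p.1 == p.2) && (q.1 == q.2))%:R else 0).

Lemma coefD S T u : coef (S + T) u = coef S u + coef T u. Proof. by []. Qed.
Lemma coef0 u : coef (0 : gseries) u = 0. Proof. by []. Qed.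
Lemma coefZ k S u : coef (k *: S) u = k * coef S u. Proof. by []. Qed.
Lemma coef_sum I (r : seq I) (P : pred I) (G : I -> gseries) u :
  coef (\sum_(i <- r | P i) G i) u = \sum_(i <- r | P i) coef (G i) u.
Proof. exact: (big_morph (fun S => coef S u) (fun S T => coefD S T u) (coef0 u)). Qed.

Lemma shiftD p x S T : shift p x (S + T) = shift p x S + shift p x T.
Proof. exact: gseriesP. Qed.
Lemma shift0 p x : shift p x 0 = 0.
Proof. exact: gseriesP. Qed.
Lemma shiftZ p x k S : shift p x (k *: S) = k *: shift p x S.
Proof. exact: gseriesP. Qed.
Lemma shift_sum p x I (r : seq I) (P : pred I) (G : I -> gseries) :
  shift p x (\sum_(i <- r | P i) G i) = \sum_(i <- r | P i) shift p x (G i).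
Proof. exact: (big_morph (shift p x) (shiftD p x) (shift0 p x)). Qed.

Lemma smul_coefE S T p s : smul_coef S T p s = coef (smul S T) (p, s).
Proof. by []. Qed.

Fact smulDl : left_distributive smul +%R.
Proof.
move=> S T U; apply: gseriesP => p s /=.
elim: s S T p => [|[x q] s IH] S T p /=.
  rewrite !addr0 -big_split; apply: eq_bigr => r _ /=; exact: mulrDl.
rewrite shiftD IH addrACA; congr (_ + _).
by rewrite -big_split; apply: eq_bigr => r _ /=; exact: mulrDl.
Qed.

Fact smulDr : right_distributive smul +%R.
Proof.
move=> S T U; apply: gseriesP => p s /=.
elim: s S p => [|[x q] s IH] S p /=.
  rewrite !addr0 -big_split; apply: eq_bigr => r _ /=; exact: mulrDr.
rewrite IH addrACA; congr (_ + _).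
by rewrite -big_split; apply: eq_bigr => r _ /=; exact: mulrDr.
Qed.

Fact smulZl k S T : smul (k *: S) T = k *: smul S T.
Proof.
apply: gseriesP => p s /=; elim: s S p => [|[x q] s IH] S p /=.
  by rewrite !addr0 mulr_sumr; apply: eq_bigr => r _; rewrite mulrA.
rewrite shiftZ IH mulrDr; congr (_ + _).
by rewrite mulr_sumr; apply: eq_bigr => r _; rewrite mulrA.
Qed.

Fact smulZr k S T : smul S (k *: T) = k *: smul S T.
Proof.
apply: gseriesP => p s /=; elim: s S p => [|[x q] s IH] S p /=.
  by rewrite !addr0 mulr_sumr; apply: eq_bigr => r _; rewrite mulrCA.
rewrite IH mulrDr; congr (_ + _).
by rewrite mulr_sumr; apply: eq_bigr => r _; rewrite mulrCA.
Qed.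

Fact smul0l T : smul 0 T = 0.
Proof. by rewrite -(scale0r (0 : gseries)) smulZl !scale0r. Qed.

Lemma smul_suml I (r : seq I) (P : pred I) (G : I -> gseries) T :
  smul (\sum_(i <- r | P i) G i) T = \sum_(i <- r | P i) smul (G i) T.
Proof.
exact: (big_morph (smul^~ T) (fun S U => smulDl S U T) (smul0l T)).
Qed.

Lemma shift_smul p x S T :
  shift p x (smul S T) =
  \sum_r coef S ((p.1, r), [::]) *: shift (r, p.2) x T + smul (shift p x S) T.
Proof.
apply: gseriesP => q s /=; rewrite coef_sum; congr (_ + _).
Qed.

Fact smulA : associative smul.
Proof.
move=> S T U; apply: gseriesP => p s /=; elim: s S T p => [|[x q] s IH] S T p.
  rewrite /= !addr0.
  under eq_bigr do rewrite addr0 mulr_sumr.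
  under [RHS]eq_bigr do rewrite addr0 mulr_suml.
  by rewrite exchange_big; do 2!apply: eq_bigr => ? _; rewrite mulrA.
rewrite /= shift_smul !smul_coefE smulDl smul_suml coefD coef_sum.
rewrite -[coef (smul (smul _ _) _) _]/(smul_coef _ _ _ _) -IH /= addrA.
congr (_ + _).
under eq_bigr => r _ do rewrite mulrDr.
rewrite big_split /=; congr (_ + _); last first.
  by apply: eq_bigr => r _; rewrite [in RHS]smul_coefE smulZl.
under eq_bigr do rewrite mulr_sumr.
under [RHS]eq_bigr do rewrite addr0 mulr_suml.
by rewrite exchange_big; do 2!apply: eq_bigr => ? _; rewrite mulrA.
Qed.

Lemma coef_iota_mul a S p s :
  coef (smul (iota a) S) (p, s) = \sum_r a p.1 r * coef S ((r, p.2), s).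
Proof.
case: s => [|[x q] s] /=; first by rewrite addr0.
have -> : shift p x (iota a) = 0 by apply: gseriesP.
by rewrite smul_coefE smul0l addr0.
Qed.

Fact smul1l : left_id (iota 1) smul.
Proof.
move=> S; apply: gseriesP => -[i j] s; rewrite coef_iota_mul (bigD1 i) //=.
rewrite mxE eqxx mul1r big1 ?addr0 // => r /negPf.
by rewrite mxE eq_sym => ->; rewrite mul0r.
Qed.

Fact smul1r : right_id (iota 1) smul.
Proof.
move=> S; apply: gseriesP => p s /=; elim: s S p => [|[x q] s IH] S [i j] /=.
  rewrite addr0 (bigD1 j) //= mxE eqxx mulr1 big1 ?addr0 // => r /negPf.
  by rewrite mxE => ->; rewrite mulr0.
by rewrite IH big1 ?add0r // => r _; rewrite mulr0.
Qed.

HB.instance Definition _ := GRing.Zmodule_isPzRing.Build gseries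
  smulA smul1l smul1r smulDl smulDr.

Lemma gscaleAl k S T : k *: (S * T) = (k *: S) * T.
Proof. by rewrite [RHS]smulZl. Qed.
Lemma gscaleAr k S T : k *: (S * T) = S * (k *: T).
Proof. by rewrite [RHS]smulZr. Qed.

Fact iota_is_additive : {morph iota : a b / a - b}.
Proof.
by move=> a b; apply: gseriesP => p [|? ?] /=; rewrite ?mxE ?subr0.
Qed.
Fact iota_is_monoid : monoid_morphism iota.
Proof.
split=> // a b; apply: gseriesP => -[i j] s; rewrite [RHS]coef_iota_mul /=.
case: s => [|_ _] /=; first by rewrite mxE.
by rewrite big1 // => r _; rewrite mulr0.
Qed.
HB.instance Definition _ :=
  GRing.isZmodMorphism.Build 'M[F]_m gseries iota iota_is_additive.
HB.instance Definition _ :=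
  GRing.isMonoidMorphism.Build 'M[F]_m gseries iota iota_is_monoid.

Lemma iotaZ k a : iota (k *: a) = k *: iota a.
Proof. by apply: gseriesP => p [|? ?] /=; rewrite ?mxE ?mulr0. Qed.


(* The element a0 x1 a1 ... xl al, for s = [:: (x1, a1); ...; (xl, al)]. *)
Definition wprod (a0 : 'M[F]_m) (s : seq (X * 'M[F]_m)) : gseries :=
  foldl (fun S t => S * letter t.1 * iota t.2) (iota a0) s.

Lemma wprod_cons a0 x a (s : seq (X * 'M[F]_m)) :
  wprod a0 ((x, a) :: s) = iota a0 * letter x * wprod a s.
Proof.
rewrite /wprod /=; move: (iota a0 * _) (iota a) => S T.
elim: s T => [//|t s IH] T /=; rewrite -IH; congr foldl.
by rewrite !mulrA.
Qed.

Lemma coef_iota_letter_mul a x S p t :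
  coef (iota a * letter x * S) (p, t) =
  if t is (y, q) :: t' then a p.1 p.2 * (x == y)%:R * coef S (q, t') else 0.
Proof.
have coefax q t' : coef (iota a * letter x) (q, t') =
    if t' is [:: (y, r)] then a q.1 q.2 * ((x == y) && (r.1 == r.2))%:R else 0.
  rewrite [LHS]coef_iota_mul; case: t' => [|[y r] [|? ?]] /=.
  - by rewrite big1 // => k _; rewrite mulr0.
  - rewrite (bigD1 q.2) //= eqxx andbT big1 ?addr0 // => k /negPf ->.
    by rewrite andbF mulr0.
  - by rewrite big1 // => k _; rewrite mulr0.
move: (iota a * letter x) coefax => Z coefax.
case: t => [|[y q] t]; rewrite [LHS]/(smul_coef _ _ _ _) /=.
  by rewrite addr0 big1 // => r _; rewrite coefax mul0r.
rewrite big1 ?add0r => [|r _]; last by rewrite coefax mul0r.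
have -> : shift p y Z = (a p.1 p.2 * (x == y)%:R) *: iota 1.
  apply: gseriesP => r [|[z k] t'] /=; rewrite coefax ?mulr0 //=.
  by rewrite mxE -mulrA -natrM mulnb.
by rewrite -[LHS]/(coef (smul _ S) (q, t)) smulZl smul1l.
Qed.

Definition monomial u : gseries := GSeries (fun v => (v == u)%:R).

Lemma monomialE u :
  monomial u = wprod (delta_mx u.1.1 u.1.2)
                 [seq (t.1, delta_mx t.2.1 t.2.2) | t <- u.2].
Proof.
case: u => p s; elim: s p => [|[x q] s IH] [i j] /=.
  apply: gseriesP => -[k l] [|? ?] /=; last by rewrite xpair_eqE andbF.
  rewrite mxE.
  by rewrite xpair_eqE andbT xpair_eqE.
rewrite wprod_cons; have {}IH := IH q; rewrite /= in IH; rewrite -IH.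
apply: gseriesP => -[k l] [|[y r] t]; rewrite coef_iota_letter_mul /=.
  by rewrite xpair_eqE andbF.
rewrite mxE -!natrM !mulnb; congr (_%:R); congr nat_of_bool.
by rewrite !xpair_eqE eqseq_cons !xpair_eqE [x == y]eq_sym !andbA.
Qed.

Definition span (G : set gseries) : set gseries :=
  [set S | exists n (k : 'I_n -> F) (v : 'I_n -> gseries),
     (forall i, G (v i)) /\ S = \sum_i k i *: v i]%classic.

(* A^w *)
Definition Hom (w : seq X) : set gseries :=
  span [set S | exists a (s : seq (X * 'M[F]_m)), unzip1 s = w /\ S = wprod a s]%classic.

(* [S, w] *)
Definition component S (w : seq X) : gseries :=
  GSeries (fun u => if mword u == w then coef S u else 0).

(* L_x S, the sum of all the components [S, xw] *)
Definition Lop (x : X) S : gseries :=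
  GSeries (fun u => if ohead (mword u) == Some x then coef S u else 0).

(* finite sums of products of an element of P and an element of M *)
Definition prods (P M : set gseries) : set gseries :=
  [set T | exists n (p t : 'I_n -> gseries),
     [/\ forall i, P (p i), forall i, M (t i) & T = \sum_i p i * t i]]%classic.

Definition lsubmodule (M : set gseries) : Prop :=
  [/\ M 0, forall T U, M T -> M U -> M (T + U)
    & forall a T, M T -> M (iota a * T)].

Definition stable (M : set gseries) : Prop :=
  forall x T, M T -> prods (Hom [:: x]) M (Lop x T).

Definition Hankel S : set gseries :=
  [set T | forall M, lsubmodule M -> stable M -> M S -> M T]%classic.

(* the left A-submodule generated by a finite set *)
Definition lgen (G : {fset gseries}) : set gseries :=
  [set T | exists a : gseries -> 'M[F]_m,
     T = \sum_(v <- G) iota (a v) * v]%classic.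

Definition finitely_generated (M : set gseries) : Prop := exists G, lgen G = M.

Definition min_generators (M : set gseries) (n : nat) : Prop :=
  (exists2 G, lgen G = M & #|` G| = n) /\
  (forall G, lgen G = M -> (n <= #|` G|)%N).

Definition representation S (n : nat) (c : 'rV['M[F]_m]_n)
    (A : X -> 'M[gseries]_n) (b : 'cV['M[F]_m]_n) : Prop :=
  (forall x i j, Hom [:: x] (A x i j)) /\
  (forall w, component S w =
     (map_mx iota c *m (\prod_(x <- w) A x) *m map_mx iota b) ord0 ord0).

Definition recognizable S : Prop := exists n c A b, @representation S n c A b.

Definition minimal_representation S (n : nat) (c : 'rV['M[F]_m]_n)
    (A : X -> 'M[gseries]_n) (b : 'cV['M[F]_m]_n) : Prop :=
  representation S c A b /\
  (forall n' c' A' b', @representation S n' c' A' b' -> (n <= n')%N).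

Lemma LopE x S :
  Lop x S = \sum_(p : munit m) iota (delta_mx p.1 p.2) * letter x * shift p x S.
Proof.
apply: gseriesP => p [|[y q] t]; rewrite coef_sum.
  rewrite big1 // => r _; exact: (coef_iota_letter_mul _ _ _ p [::]).
rewrite (bigD1 p) // big1 => [|r rp]; last first.
  rewrite (coef_iota_letter_mul _ _ _ p ((y, q) :: t)) mxE.
  rewrite -xpair_eqE -!surjective_pairing.
  by rewrite eq_sym (negPf rp) !mul0r.
rewrite [RHS]Monoid.mulm1 (coef_iota_letter_mul _ _ _ p ((y, q) :: t)) mxE.
rewrite !eqxx mul1r /mword /= (inj_eq Some_inj) eq_sym.
by case: eqP => [->|xy]; rewrite ?mul1r ?mul0r.
Qed.

Lemma span0 G : span G 0.
Proof. by exists 0%N, (fun=> 0), (fun=> 0); split; [case | rewrite big_ord0]. Qed.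

Lemma spanD G S T : span G S -> span G T -> span G (S + T).
Proof.
move=> [n [k [v [Gv ->]]]] [n' [k' [v' [Gv' ->]]]].
pose h I (f : 'I_n -> I) (f' : 'I_n' -> I) (i : 'I_(n + n')) :=
  match split i with inl j => f j | inr j => f' j end.
exists (n + n')%N, (h _ k k'), (h _ v v'); split=> [i|].
  by rewrite /h; case: split.
rewrite big_split_ord; congr (_ + _); apply: eq_bigr => i _; rewrite /h.
  by have := unsplitK (inl i : 'I_n + 'I_n'); rewrite /unsplit /= => ->.
by have := unsplitK (inr i : 'I_n + 'I_n'); rewrite /unsplit /= => ->.
Qed.

Lemma HomP w S : Hom w S <-> (forall u, mword u <> w -> coef S u = 0).
Proof.
split=> [[n [k [v [vw ->]]]] u uw|].
  rewrite coef_sum big1 // => i _; rewrite coefZ; case: (vw i) => a [s [sw ->]].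
  suff -> : coef (wprod a s) u = 0 by rewrite mulr0.
  case: u uw => p t; rewrite /mword /= -sw {vw sw k v w i S n}.
  elim: s a p t => [|[x b] s IH] a p t /=; first by case: t.
  rewrite wprod_cons coef_iota_letter_mul; case: t => [//|[y q] t] /= ts.
  case: eqP => [xy|_]; last by rewrite mulr0 mul0r.
  by rewrite IH ?mulr0 // => ts'; apply: ts; rewrite xy ts'.
elim: w S => [|x w IH] S Sw.
  exists 1%N, (fun=> 1), (fun=> S); split=> [_|]; last first.
    by rewrite big_ord1 scale1r.
  exists (\matrix_(i, j) coef S ((i, j), [::])), [::]; split=> //.
  apply: gseriesP => -[i j] [|[y q] t] /=; first by rewrite mxE.
  by apply: Sw.
have -> : S = Lop x S.
  apply: gseriesP => p t /=; case: eqP => // tx; apply: Sw => tw.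
  by rewrite tw in tx.
rewrite LopE.
apply: (big_ind (Hom (x :: w))) => [||p _]; first exact: span0.
  by move=> T U; apply: spanD.
have [n [k [v [vw ->]]]] : Hom w (shift p x S).
  by apply: IH => -[q t] tw; apply: Sw; rewrite /mword /= => -[].
exists n, k, (fun i => iota (delta_mx p.1 p.2) * letter x * v i); split=> [i|].
  have [a [s [sw ->]]] := vw i.
  by exists (delta_mx p.1 p.2), ((x, a) :: s); rewrite /= sw wprod_cons.
by rewrite mulr_sumr; apply: eq_bigr => i _; rewrite gscaleAr.
Qed.

Lemma component_Hom S w : Hom w (component S w).
Proof. by apply/HomP => u /eqP /negPf /= ->. Qed.

Lemma component_Lop x S w :
  component (Lop x S) w = if ohead w == Some x then component S w else 0.
Proof.
apply: gseriesP => p s /=; case: (ohead w == _) / (boolP (ohead w == Some x)).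
  by move=> wx /=; case: eqP => // ->; rewrite wx.
by move=> wx /=; case: eqP => // ->; rewrite (negPf wx).
Qed.

Lemma shift_Hom_mul p x S T :
  Hom [:: x] S -> exists a, shift p x (S * T) = iota a * T.
Proof.
move=> /HomP Sx; exists (\matrix_(i, j) coef S (p, [:: (x, (i, j))])).
rewrite [LHS]shift_smul big1 ?add0r => [|r _]; last by rewrite Sx ?scale0r.
congr (smul _ T); apply: gseriesP => -[i j] [|? ?] /=; first by rewrite mxE.
by rewrite Sx // => -[].
Qed.

Lemma shift_Lop p x S : shift p x (Lop x S) = shift p x S.
Proof. by apply: gseriesP => q s; rewrite /= eqxx. Qed.

Lemma stable_shift M p x T : lsubmodule M -> stable M -> M T -> M (shift p x T).
Proof.
move=> [M0 MD MZ] sM /(sM x) [n [P [t [Px Mt /(congr1 (shift p x))]]]].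
rewrite shift_Lop shift_sum => ->; apply: big_ind => // i _.
by have [a ->] := shift_Hom_mul p (t i) (Px i); apply: MZ.
Qed.

Lemma Hankel_lsubmodule S : lsubmodule (Hankel S).
Proof.
split=> [M [] //|T U HT HU M lM sM MS|a T HT M lM sM MS].
  by case: (lM) => _ MD _; apply: MD; [apply: HT | apply: HU].
by case: (lM) => _ _ MZ; apply: MZ; apply: HT.
Qed.

Lemma Hankel_stable S : stable (Hankel S).
Proof.
move=> x T HT; rewrite LopE.
exists #|munit m|, (fun i => iota (delta_mx (enum_val i).1 (enum_val i).2) *
  letter x), (fun i => shift (enum_val i) x T); split=> [i|i|].
- apply/HomP => -[p t]; rewrite -[_ * letter x]mulr1.
  rewrite coef_iota_letter_mul /mword; case: t => [//|[y q] [|? ?]] /= yx;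
    last by rewrite mulr0.
  by case: eqP yx => [->|_ _] //; rewrite mulr0 mul0r.
- move=> N lN sN NS; exact: (stable_shift _ _ lN sN (HT N lN sN NS)).
- by rewrite -(big_enum_val (A := predT) (fun p : munit m =>
    iota (delta_mx p.1 p.2) * letter x * shift p x T)).
Qed.

Lemma Hankel_smallest S :
  [/\ lsubmodule (Hankel S), stable (Hankel S), Hankel S S
    & forall M, lsubmodule M -> stable M -> M S -> (Hankel S `<=` M)%classic].
Proof.
split; [exact: Hankel_lsubmodule | exact: Hankel_stable | by move=> M |].
by move=> M lM sM MS T; apply.
Qed.

End Ring.

Arguments iota {F m X} a.
Arguments letter {F m X} x.

(* Main.v *)
Require Import Defs.
From mathcomp Require Import all_boot all_algebra finmap.
From mathcomp Require Import boolp classical_sets zify.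

(** Both halves of the theorem pass between generators of the Hankel module and
    the coordinates of a representation.

    If [v_1, ..., v_n] generate the Hankel module of [S], expanding [S] gives
    the row [c], expanding the series [L_x v_i] gives the matrices [A^x], and
    the constant terms of the [v_i] give the column [b]: so a generating set of
    [n] elements yields a representation of dimension [n]
    ([generators_representation]).

    Conversely, a representation [(c, A, b)] of dimension [n] defines the series
    [v_i = sum_w (A^w b)_i].  The left module that they generate is stable and
    contains [S], so that it contains the Hankel module.  It remains to see that
    a submodule of a module with [n] generators again has at most [n]
    generators.  As over a principal ideal domain, this follows by induction on
    [n] from the fact that every left ideal of a matrix algebra over a field is
    principal ([left_ideal_principal], [lsubmodule_lgen]).

    The dimensions of representations and the cardinalities of generating sets
    therefore have the same minimum.

    Everything is computed with the operators [shift p x], which remove the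
    prefix [e_p x] from each monomial: by [LopE], [L_x T] is the sum over [p] of
    [e_p x (shift p x T)], so that a submodule is stable as soon as it is closed
    under these operators. *)

Set Implicit Arguments.
Unset Strict Implicit.
Unset Printing Implicit Defensive.

Import GRing.Theory.
Local Open Scope ring_scope.

(** * Left ideals of a matrix algebra *)

(** A left ideal of square matrices consists of the matrices whose row space lies
    in a fixed space, and an element [g] of maximal rank has that row space: for
    [a] in the ideal, the sum of the row spaces of [a] and [g] is the row space
    of an element of the ideal, so its rank does not exceed that of [g]. *)
Lemma left_ideal_principal (F : fieldType) (m : nat) (I : 'M[F]_m -> Prop) :
    I 0 -> (forall a b, I a -> I b -> I (a + b)) ->
    (forall d a, I a -> I (d *m a)) ->
  exists2 g, I g & forall a, I a -> exists d, a = d *m g.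
Proof.
move=> I0 ID IM.
pose P r := `[< exists2 a, I a & \rank a = r >].
have exP : exists r, P r by exists (\rank (0 : 'M[F]_m)); apply/asboolP; exists 0.
have ubP r : P r -> (r <= m)%N by move=> /asboolP [a _ <-]; apply: rank_leq_row.
case: (ex_maxnP exP ubP) => _ /asboolP [g Ig <-] max_g.
exists g => // a Ia; apply/submxP.
have Iag : I (a + g)%MS.
  have /submxP [d ->] : ((a + g)%MS <= col_mx a g)%MS by rewrite addsmxE.
  by rewrite -[d]hsubmxK mul_row_col; apply: ID; apply: IM.
have rk_ag : (\rank (a + g)%MS <= \rank g)%N.
  by apply: max_g; apply/asboolP; exists (a + g)%MS.
by apply: submx_trans (addsmxSl a g) _; rewrite -(geq_leqif (mxrank_leqif_sup _)) ?addsmxSr.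
Qed.

Section Hankel.
Variables (F : fieldType) (m : nat) (X : finType).
Local Notation gseries := (gseries F m X).
Local Notation iota := (@Defs.iota F m X).
Local Notation Hom := (@Defs.Hom F m X).
Implicit Types (S T U : gseries) (M N : set gseries) (G : {fset gseries}).

(** * Finitely generated submodules *)

Lemma lsubmoduleB N T U : lsubmodule N -> N T -> N U -> N (T - U).
Proof.
move=> [_ ND NM] NT NU; apply: ND => //.
by have := NM (- 1) _ NU; rewrite rmorphN rmorph1 mulN1r.
Qed.

Lemma lsubmoduleZ N k T : lsubmodule N -> N T -> N (k *: T).
Proof.
move=> [_ _ NM] /(NM k%:M); rewrite -scalemx1 iotaZ.
by rewrite -[1%:M]/(1 : 'M[F]_m) rmorph1 -gscaleAl mul1r.
Qed.

Lemma lsubmodule_sum N (I : finType) (f : I -> gseries) :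
  lsubmodule N -> (forall i, N (f i)) -> N (\sum_i f i).
Proof. by move=> [N0 ND _] Nf; apply: big_ind => // i _; apply: Nf. Qed.

Lemma lsubmoduleI M N :
  lsubmodule M -> lsubmodule N -> lsubmodule (M `&` N)%classic.
Proof.
move=> [M0 MD MM] [N0 ND NM]; split=> [|T U [MT NT] [MU NU]|a T [MT NT]].
- by split.
- by split; [apply: MD | apply: ND].
- by split; [apply: MM | apply: NM].
Qed.

Lemma lgen_lsubmodule G : lsubmodule (lgen G).
Proof.
split=> [|T U [a ->] [b ->]|a T [b ->]].
- by exists (fun=> 0); rewrite big1 // => v _; rewrite rmorph0 mul0r.
- exists (fun v => a v + b v); rewrite -big_split.
  by apply: eq_bigr => v _; rewrite rmorphD mulrDl.
- exists (fun v => a *m b v); rewrite mulr_sumr.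
  by apply: eq_bigr => v _; rewrite -[_ *m _]/(a * b v) rmorphM mulrA.
Qed.

Lemma lgen_gen G v : v \in G -> lgen G v.
Proof.
move=> Gv; exists (fun u => if u == v then 1 else 0).
rewrite (big_fsetD1 v) //= eqxx rmorph1 mul1r big_seq big1 ?addr0 // => u.
by rewrite !inE => /andP [/negPf -> _]; rewrite rmorph0 mul0r.
Qed.

Lemma lgen_min G N :
  lsubmodule N -> (forall v, v \in G -> N v) -> (lgen G `<=` N)%classic.
Proof.
move=> [N0 ND NM] GN T [a ->]; rewrite big_seq.
by apply: big_ind => // v /GN; apply: NM.
Qed.

(** Induction on the generators of the ambient module, as over a principal ideal
    domain: the coefficients on one generator [v] of the elements of [N]
    form a left ideal; if [h] in [N] has as coefficient a generator of this
    ideal, then subtracting a multiple of [h] moves any element of [N] into the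
    module spanned by the other generators. *)
Lemma lsubmodule_lgen G N : lsubmodule N -> (N `<=` lgen G)%classic ->
  exists2 G', lgen G' = N & (#|` G'| <= #|` G|)%N.
Proof.
elim/fset1U_rect: G N => [|v G Gv IH] N lN NG.
  exists fset0; last by rewrite cardfs0.
  apply/seteqP; split=> [T [a ->]|T /NG //].
  by rewrite big_seq_fset0; case: lN.
pose I (a : 'M[F]_m) := exists2 T, lgen G T & N (iota a * v + T).
have [G0 GD GM] := lgen_lsubmodule G; have [N0 ND NM] := lN.
have [|a b [T GT NT] [U GU NU]|d a [T GT NT]|g [T0 GT0 Nh] Ig] :=
  @left_ideal_principal F m I.
- by exists 0 => //; rewrite rmorph0 mul0r addr0.
- by exists (T + U); [apply: GD | rewrite rmorphD mulrDl addrACA; apply: ND].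
- exists (iota d * T); first exact: GM.
  by rewrite -[d *m a]/(d * a) rmorphM -mulrA -mulrDr; apply: NM.
have [||G' eG' leG'] := IH (N `&` lgen G)%classic.
- exact: lsubmoduleI (lgen_lsubmodule G).
- exact: subIsetr.
set h := iota g * v + T0 in Nh.
exists (h |` G')%fset; last by rewrite !cardfsU1 Gv; case: (h \in G'); lia.
apply/seteqP; split=> [|T NT].
  apply: lgen_min => // u /fset1UP [-> //|/lgen_gen]; rewrite eG'; exact: proj1.
have [G'0 G'D G'M] := lgen_lsubmodule (h |` G')%fset.
have [a eT] := NG T NT; rewrite big_fsetU1 //= in eT.
move: (\sum_(i <- _) _) (ex_intro _ a erefl : lgen G (\sum_(i <- G) iota (a i) * i)) eT.
move=> T1 GT1 eT.
(* Subtracting [d h] from [T] cancels the coefficient of [T] on [v]. *)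
have [|d ad] := Ig (a v); first by exists T1; rewrite -?eT.
have rT : lgen G' (T - iota d * h).
  rewrite eG'; split; first by apply: lsubmoduleB => //; apply: NM.
  have -> : T - iota d * h = T1 - iota d * T0.
    rewrite eT ad -[d *m g]/(d * g) rmorphM /h mulrDr mulrA opprD addrACA.
    by rewrite subrr add0r.
  by apply: lsubmoduleB; [apply: lgen_lsubmodule | | apply: GM].
rewrite -[T](subrK (iota d * h)); apply: G'D; last first.
  by apply: G'M; apply: lgen_gen; rewrite fset1U1.
apply: lgen_min rT; first exact: lgen_lsubmodule.
by move=> u G'u; apply: lgen_gen; rewrite fset1Ur.
Qed.

(** * Removing prefixes *)

Lemma coef_iotaM a T (p : munit m) s :
  coef (iota a * T) (p, s) = \sum_r a p.1 r * coef T ((r, p.2), s).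
Proof. exact: coef_iota_mul. Qed.

Lemma shift_iotaM p (x : X) a T :
  shift p x (iota a * T) = \sum_r a p.1 r *: shift (r, p.2) x T.
Proof.
have a0 : shift p x (iota a) = 0 by apply: gseriesP.
by rewrite [LHS]shift_smul a0 smul0l addr0.
Qed.

Lemma shift_HomM p (x : X) U T :
  Hom [:: x] U -> shift p x (U * T) = shift p x U * T.
Proof.
move=> /HomP Ux; rewrite [LHS]shift_smul big1 ?add0r // => r _.
by rewrite Ux ?scale0r.
Qed.

Lemma shift_Hom p (x : X) U : Hom [:: x] U -> exists a, shift p x U = iota a.
Proof.
by move=> /(shift_Hom_mul p 1) [a]; rewrite !mulr1 => e; exists a.
Qed.

Lemma Hom_iota_letter a (x : X) b : Hom [:: x] (iota a * letter x * iota b).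
Proof.
exists 1%N, (fun=> 1), (fun=> iota a * letter x * iota b).
by split=> [_|]; [exists a, [:: (x, b)] | rewrite big_ord1 scale1r].
Qed.

(** The factors [e_p x] in [LopE] lie in [A^x], hence a submodule that contains
    all the [shift p x T] contains [L_x T] up to such factors. *)
Lemma shift_stable M :
  (forall p x T, M T -> M (shift p x T)) -> stable M.
Proof.
move=> Msh x T MT; rewrite LopE.
exists #|munit m|, (fun i => iota (delta_mx (enum_val i).1 (enum_val i).2) *
  letter x), (fun i => shift (enum_val i) x T); split=> [i|i|].
- by rewrite -[_ * letter x]mulr1 -(rmorph1 iota); apply: Hom_iota_letter.
- exact: Msh.
- by rewrite -(big_enum_val (A := predT) (fun p : munit m =>
    iota (delta_mx p.1 p.2) * letter x * shift p x T)).
Qed.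

(** Stability need only be checked on generators: [shift p x] is not [A]-linear,
    but it sends [a T] to a combination of the [shift (r, p.2) x T]. *)
Lemma lgen_stable G :
  (forall p x v, v \in G -> lgen G (shift p x v)) -> stable (lgen G).
Proof.
move=> Gsh; apply: shift_stable => p x T GT; move: p.
have lG := lgen_lsubmodule G; have [G0 GD _] := lG.
apply: (@lgen_min G (fun U => forall p, lgen G (shift p x U))) GT => //.
- split=> [p|U V GU GV p|a U GU p]; first by rewrite shift0.
  + by rewrite shiftD; apply: GD.
  + by rewrite shift_iotaM; apply: lsubmodule_sum => // r; apply: lsubmoduleZ.
- by move=> v Gv p; apply: Gsh.
Qed.

(** * Components of a series *)

Lemma component_iotaM a T w :
  component (iota a * T) w = iota a * component T w.
Proof.
apply: gseriesP => p s; rewrite coef_iotaM /= /mword /=.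
case: eqP => _; first by rewrite -coef_iotaM.
by rewrite big1 // => r _; rewrite mulr0.
Qed.

Lemma component_sum (I : finType) (f : I -> gseries) w :
  component (\sum_i f i) w = \sum_i component (f i) w.
Proof.
apply: gseriesP => p s; rewrite Defs.coef_sum /= Defs.coef_sum.
by case: eqP => // _; rewrite big1.
Qed.

Lemma component_nil T :
  component T [::] = iota (\matrix_(k, l) coef T ((k, l), [::])).
Proof. by apply: gseriesP => -[k l] [|[y q] s] //=; rewrite mxE. Qed.

(** Reading a word from its first letter: this recursion is what matches
    [A^(xw) = A^x A^w]. *)
Lemma component_cons T x w :
  component T (x :: w) = \sum_(p : munit m)
    iota (delta_mx p.1 p.2) * letter x * component (shift p x T) w.
Proof.
have -> : component T (x :: w) = component (Lop x T) (x :: w).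
  by rewrite component_Lop /= eqxx.
apply: gseriesP => p s; rewrite LopE component_sum !Defs.coef_sum.
apply: eq_bigr => r _.
rewrite [RHS](coef_iota_letter_mul _ _ _ p s) /component.
rewrite [LHS]/= [X in if _ then X else _](coef_iota_letter_mul _ _ _ p s).
case: s => [|[y q] s] //=; rewrite /mword /= eqseq_cons.
by have [_ | _] /= := eqVneq y x; [case: eqP; rewrite ?mulr0 | rewrite mulr0 mul0r].
Qed.

(** * From generators to a representation *)

(** The coefficient matrices [a p x i j] expand [shift p x (v_i)] on the
    generators, so that the letter matrix with entries
    [sum_p e_p x (a p x i j)] expands [L_x v_i]. *)
Lemma generators_representation S G : lgen G = Hankel S ->
  exists c A b, @representation F m X S #|` G| c A b.
Proof.
move=> GH; have [lH sH HS _] := Hankel_smallest S.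
set n := #|` G|; pose v (i : 'I_n) := nth 0 G i.
have lgenE T : Hankel S T -> exists a, T = \sum_(i < n) iota (a i) * v i.
  rewrite -GH => -[a ->]; exists (fun i => a (v i)).
  by rewrite (big_nth 0) big_mkord.
have Hv i : Hankel S (v i).
  by rewrite -GH; apply: lgen_gen; exact: mem_nth (ltn_ord i).
have [c Sc] := lgenE S HS.
have /choice [a sha] (t : munit m * X * 'I_n) :
    exists a, shift t.1.1 t.1.2 (v t.2) = \sum_(j < n) iota (a j) * v j.
  by apply: lgenE; apply: stable_shift lH sH (Hv _).
pose A x := \matrix_(i < n, j < n) \sum_(p : munit m)
  iota (delta_mx p.1 p.2) * letter x * iota (a (p, x, i) j).
pose b := \col_(i < n) \matrix_(k, l) coef (v i) ((k, l), [::]).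
have Wv w i : (\prod_(x <- w) A x *m map_mx iota b) i ord0 = component (v i) w.
  elim: w i => [|x w IH] i; first by rewrite big_nil mul1mx !mxE component_nil.
  rewrite big_cons -mulmxA mxE component_cons.
  have -> : \sum_j A x i j * (\prod_(y <- w) A y *m map_mx iota b) j ord0 =
      \sum_j A x i j * component (v j) w.
    by apply: eq_bigr => j _; congr (_ * _); apply: IH.
  under eq_bigr => j _ do rewrite mxE mulr_suml.
  rewrite exchange_big; apply: eq_bigr => p _.
  rewrite (sha (p, x, i)) component_sum mulr_sumr; apply: eq_bigr => j _.
  by rewrite component_iotaM mulrA.
exists (\row_i c i), A, b; split=> [x i j|w].
  rewrite mxE; apply: big_ind => [||p _]; first exact: span0.
    exact: spanD.
  exact: Hom_iota_letter.
rewrite -mulmxA mxE {1}Sc component_sum; apply: eq_bigr => i _.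
by rewrite Wv !mxE component_iotaM.
Qed.

(** * From a representation to generators *)

(** The series [sum_w (A^w b)_i]: only the word of [u] contributes to the
    coefficient at [u]. *)
Definition rep_series n (A : X -> 'M[gseries]_n) (b : 'cV['M[F]_m]_n) i :=
  GSeries (fun u =>
    coef ((\prod_(x <- mword u) A x *m map_mx iota b) i ord0) u).

Lemma rep_seriesE S n c (A : X -> 'M[gseries]_n) b :
  representation S c A b -> S = \sum_i iota (c ord0 i) * rep_series A b i.
Proof.
move=> [_ Sw]; apply: gseriesP => p s.
have := congr1 (fun T => coef T (p, s)) (Sw (unzip1 s)).
rewrite /= /mword /= eqxx => ->; rewrite -mulmxA mxE !Defs.coef_sum.
by apply: eq_bigr => i _; rewrite mxE !coef_iotaM.
Qed.

(** Removing the first letter from [A^(xw) b = A^x (A^w b)] leaves coefficients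
    of the entries of [A^x], which lie in [A]: this makes the module generated
    by the [rep_series] stable. *)
Lemma shift_rep_series n (A : X -> 'M[gseries]_n) b p x i :
    (forall x i j, Hom [:: x] (A x i j)) ->
  shift p x (rep_series A b i) =
  \sum_j shift p x (A x i j) * rep_series A b j.
Proof.
move=> HA; apply: gseriesP => q s.
set W := (\prod_(y <- unzip1 s) A y *m map_mx iota b).
have -> : coef (shift p x (rep_series A b i)) (q, s) =
    coef (shift p x ((A x *m W) i ord0)) (q, s).
  by rewrite /= /mword /= big_cons -mulmxA.
rewrite mxE shift_sum !Defs.coef_sum; apply: eq_bigr => j _; rewrite shift_HomM //.
by have [a ->] := shift_Hom p (HA x i j); rewrite !coef_iotaM.
Qed.

(** The [rep_series] generate a stable module around the Hankel module, which
    need not be the Hankel module itself: hence an inequality. *)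
Lemma representation_generators S n c A b : @representation F m X S n c A b ->
  exists2 G, lgen G = Hankel S & (#|` G| <= n)%N.
Proof.
move=> rS; have [HA _] := rS.
pose G := [fset rep_series A b i | i in 'I_n]%fset.
have leGn : (#|` G| <= n)%N.
  by apply: leq_trans (leq_imfset_card _ _ _) _; rewrite -cardE card_ord.
have lG := lgen_lsubmodule G.
have Gsum (a : 'I_n -> 'M[F]_m) : lgen G (\sum_i iota (a i) * rep_series A b i).
  apply: lsubmodule_sum => // i; have [_ _ GM] := lG.
  by apply: GM; apply: lgen_gen; apply/imfsetP; exists i.
have sG : stable (lgen G).
  apply: lgen_stable => p x _ /imfsetP [i _ ->]; rewrite shift_rep_series //.
  have /choice [a sha] j := shift_Hom p (HA x i j).
  by under eq_bigr do rewrite sha.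
have [lH _ _ Hmin] := Hankel_smallest S.
have [|G' GH leG'] := @lsubmodule_lgen G (Hankel S) lH.
  by apply: Hmin => //; rewrite (rep_seriesE rS).
by exists G' => //; apply: leq_trans leG' _.
Qed.

End Hankel.

Theorem theorem4p18 (F : fieldType) (char0 : [pchar F] =i pred0)
    (m : nat) (m_gt0 : (0 < m)%N) (X : finType) (S : gseries F m X) :
  (finitely_generated (Hankel S) <-> recognizable S) /\
  (finitely_generated (Hankel S) ->
     exists n : nat,
       (exists c A b, @minimal_representation F m X S n c A b) /\
       min_generators (Hankel S) n).
Proof.
split; first split=> [[G GH]|[n [c [A [b rS]]]]].
- by exists #|` G|; apply: generators_representation.
- by have [G GH _] := representation_generators rS; exists G.
move=> [G0 G0H].
pose P n := `[< exists2 G, lgen G = Hankel S & #|` G| = n >].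
have exP : exists n, P n by exists #|` G0|; apply/asboolP; exists G0.
case: (ex_minnP exP) => _ /asboolP [G GH <-] minG.
have leG G' : lgen G' = Hankel S -> (#|` G| <= #|` G'|)%N.
  by move=> G'H; apply: minG; apply/asboolP; exists G'.
exists #|` G|; split; last by split; first exists G.
have [c [A [b rS]]] := generators_representation GH.
exists c, A, b; split=> // n' c' A' b' /representation_generators [G' G'H].
exact: leq_trans (leG G' G'H).
Qed.
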